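(* Let $\mu^s$ be a positive sampling policy and let $(\mu^t)_{t\in[T]}$ be any sequence of min-player policies with $\mu^t$ $\mathcal F^{t-1}$-measurable. Then for every $\delta\in(0,1)$, with probability at least $1-\delta$, \[\mathcal R^T_{\min}\le\max\{\hat{\mathcal R}^T_{\min},0\}+4\sqrt{\iota H\kappa(\mu^s)T},\qquad \iota=\log\big((A_{\mathcal X}+1)/\delta\big).\]
   Context: Game structure. Fix an integer $H\ge1$. The min-player's information sets form a finite set $\mathcal X$; each $x\in\mathcal X$ has a depth $h(x)\in\{1,\dots,H\}$ and a finite nonempty action set $\mathcal A(x)$. Perfect recall: every $x$ of depth $h$ has a unique history $(x_1,a_1,\dots,x_{h-1},a_{h-1},x_h=x)$ with $x_i$ of depth $i$ and $a_i\in\mathcal A(x_i)$. $A_{\mathcal X}=\sum_{x}|\mathcal A(x)|$. A policy is $\mu=(\mu(\cdot|x))_{x\in\mathcal X}$ with $\mu(\cdot|x)\in\Delta_{\mathcal A(x)}$; $\Pi_{\min}$ is the set of policies; $\mu$ is positive if $\mu(a|x)>0$ for all $x,a$. For $x$ of depth $h$ with history $(x_1,a_1,\dots,x_h=x)$ and $a\in\mathcal A(x)$, putting $a_h=a$, the realization plan is $\mu_{1:}(x,a)=\prod_{i=1}^h\mu(a_i|x_i)$. $\langle\cdot,\cdot\rangle$ is the standard inner product on $\mathbb R^{A_{\mathcal X}}$ indexed by pairs $(x,a)$. For positive $\mu^s$, $\kappa(\mu^s)=\max_{\mu\in\Pi_{\min}}\sum_{x\in\mathcal X}\sum_{a\in\mathcal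 A(x)}\mu_{1:}(x,a)/\mu^s_{1:}(x,a)$. Episodes and protocol. For each max-player policy $\nu$ there are numbers $p^\nu_{1:}(x)\in[0,1]$ and $\ell^\nu_h(x,a)\in[0,1]$ ($x$ of depth $h$) such that an episode played with min-player policy $\mu$ against $\nu$ produces a random trajectory $(x_1,a_1,\ell_1,\dots,x_H,a_H,\ell_H)$ with $x_h$ of depth $h$, $a_h\in\mathcal A(x_h)$, $\ell_h\in[0,1]$, and for every $x$ of depth $h$ and $a\in\mathcal A(x)$: $\mathbb P(x_h=x,a_h=a)=p^\nu_{1:}(x)\mu_{1:}(x,a)$ and $\mathbb E[\ell_h\mathbf 1\{x_h=x,a_h=a\}]=p^\nu_{1:}(x)\mu_{1:}(x,a)\ell^\nu_h(x,a)$. Set $\ell^\nu(x,a)=p^\nu_{1:}(x)\ell^\nu_h(x,a)$. Fix a filtration $(\mathcal F^t)_{t=0}^T$. At each round $t=1,\dots,T$, a max-player policy $\nu^t$ is $\mathcal F^{t-1}$-measurable; conditionally on $\mathcal F^{t-1}$ the min-player observes a trajectory $(x^t_h,a^t_h,\ell^t_h)_{h\le H}$ distributed as an episode played with $(\mu^s,\nu^t)$, and it is $\mathcal F^t$-measurable. Set $\ell^t=\ell^{\nu^t}$ and $\mathcal R^T_{\min}=\max_{\mu^\dagger\in\Pi_{\min}}\sum_{t=1}^T\langle\ell^t,\mu^t_{1:}-\mu^\dagger_{1:}\rangle$. The estimated loss is $\hat\ell^t(x,a)=\mathbf 1\{x=x^t_h,a=a^t_h\}\ell^t_h/\mu^s_{1:}(x,a)$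 for $x$ of depth $h$, and the estimated regret is $\hat{\mathcal R}^T_{\min}=\max_{\mu^\dagger\in\Pi_{\min}}\sum_{t=1}^T\langle\hat\ell^t,\mu^t_{1:}-\mu^\dagger_{1:}\rangle$. *)

(* Defs.v *)
From HB Require Import structures.
From mathcomp Require Import all_boot all_order all_algebra.
From mathcomp Require Import all_classical all_reals all_analysis.

Set Implicit Arguments.
Unset Strict Implicit.
Unset Printing Implicit Defensive.

Import Order.TTheory GRing.Theory Num.Theory.
Local Open Scope classical_set_scope.
Local Open Scope ring_scope.

Section Game.
Variables (R : realType) (X Act : finType).

(** Game structure of the min-player: depth function, action sets, and
    perfect recall encoded by the parent map: [par x = None] iff [x] has
    depth 1, and otherwise [par x = Some (y, b)] with [y] of depth
    [depth x - 1] and [b] an action at [y]; iterating [par] yields the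
    unique history [(x_1,a_1,...,x_{h-1},a_{h-1},x_h = x)]. *)
Definition game_wf (H : nat) (depth : X -> nat) (Aset : X -> {set Act})
    (par : X -> option (X * Act)) : Prop :=
  [/\ (1 <= H)%N,
      (forall x, (1 <= depth x <= H)%N),
      (forall x, (0 < #|Aset x|)%N) &
      (forall x, match par x with
                 | None => depth x = 1%N
                 | Some (y, b) => depth x = (depth y).+1 /\ b \in Aset y
                 end)].

Definition is_policy (Aset : X -> {set Act}) (mu : X -> Act -> R) : Prop :=
  forall x, (forall a, a \in Aset x -> 0 <= mu x a) /\
            \sum_(a in Aset x) mu x a = 1.

Definition positive_policy (Aset : X -> {set Act}) (mu : X -> Act -> R) :=
  is_policy Aset mu /\ forall x a, a \in Aset x -> 0 < mu x a.

Fixpoint rplan_fuel (par : X -> option (X * Act)) (mu : X -> Act -> R)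
    (n : nat) (x : X) (a : Act) : R :=
  match n with
  | 0 => mu x a
  | n'.+1 => mu x a * (match par x with
                       | None => 1
                       | Some (y, b) => rplan_fuel par mu n' y b
                       end)
  end.

(** mu_{1:}(x,a) = prod_{i=1}^h mu(a_i|x_i); fuel H suffices since depths
    are at most H. *)
Definition rplan (H : nat) (par : X -> option (X * Act)) (mu : X -> Act -> R)
    (x : X) (a : Act) : R := rplan_fuel par mu H x a.

Definition inner (Aset : X -> {set Act}) (f g : X -> Act -> R) : R :=
  \sum_x \sum_(a in Aset x) f x a * g x a.

Definition A_X (Aset : X -> {set Act}) : nat := (\sum_x #|Aset x|)%N.

Definition kappa (H : nat) (Aset : X -> {set Act})
    (par : X -> option (X * Act)) (mus : X -> Act -> R) : R :=
  sup [set r | exists mu, is_policy Aset mu /\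
      r = \sum_x \sum_(a in Aset x) rplan H par mu x a / rplan H par mus x a].

Definition regret (T H : nat) (Aset : X -> {set Act})
    (par : X -> option (X * Act)) (l : nat -> X -> Act -> R)
    (mu : nat -> X -> Act -> R) : R :=
  sup [set r | exists mud, is_policy Aset mud /\
      r = \sum_(1 <= t < T.+1)
            inner Aset (l t) (fun x a => rplan H par (mu t) x a
                                          - rplan H par mud x a)].

End Game.

Section Prob.
Variables (d : measure_display) (Om : measurableType d) (R : realType).

Definition filtration (T : nat) (F : nat -> set (set Om)) : Prop :=
  (forall t, (t <= T)%N -> sigma_algebra setT (F t) /\ F t `<=` measurable) /\
  (forall t, (t < T)%N -> F t `<=` F t.+1).

Definition Gmeas (G : set (set Om)) (f : Om -> R) : Prop :=
  forall B : set R, measurable B -> G (f @^-1` B).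

Definition Gmeas_fin (T : finType) (G : set (set Om)) (f : Om -> T) : Prop :=
  forall y, G (f @^-1` [set y]).

End Prob.

(* Main.v *)
Require Import Defs.
From HB Require Import structures.
From mathcomp Require Import all_boot all_order all_algebra.
From mathcomp Require Import all_classical all_reals all_analysis.
From mathcomp Require Import measurable_realfun ring lra.

Import Order.TTheory GRing.Theory Num.Theory.
Import numFieldNormedType.Exports.
Local Open Scope classical_set_scope.
Local Open Scope ring_scope.

(** Write q for the realization plan of the sampling policy, k for kappa and
    S = sqrt(iota H k T).  Since exp u <= 1 + u + u^2 for u <= 1, exponential
    supermartingales give, outside an event of probability delta,
    (i) sum_t <l^t - lhat^t, mu^t> <= 2 S, because <lhat^t, mu^t>^2 has
    conditional mean at most H k (Cauchy-Schwarz over the depths), and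
    (ii) for each (x,a), sum_t (lhat^t - l^t)(x,a) <=
    c sum_t l^t(x,a) + iota / (c q(x,a)), where c = min(S / (H T), 1).
    Summing (ii) against a comparator m gives
    sum_t <lhat^t - l^t, m> <= c sum_t <l^t, m> + iota k / c,
    which is at most 2 S when c < 1 and sum_t <l^t, m> <= H T.  In all other
    cases (i) suffices, by comparison with the sampling policy: its estimated
    loss is at most H per round, hence
    sum_t <lhat^t, mu^t> <= Rhat + H T.  The laws of the trajectories are
    only given for the sampling policy, so <l^t, m> <= H is not available for
    a general policy m; this case distinction replaces it. *)

(** * Bounded measurable functions and their expectations *)

Section BoundedMeasurable.
Context {d : measure_display} {Om : measurableType d} {R : realType}.
Implicit Types (G : set (set Om)) (f g : Om -> R).

Definition bmeas G f :=
  Gmeas G f /\ exists M : R, forall w, `|f w| <= M.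

(** Equips a bare family [G] of sets with the measurable type it generates, so that the closure
    properties of [measurable_fun] carry over to each member of a filtration. *)
Lemma Gmeas_measurable_fun G f : sigma_algebra setT G ->
  Gmeas G f <-> measurable_fun setT (f : g_sigma_algebraType G -> R).
Proof.
move=> sG; split=> [Gf _ B mB|mf B mB].
  by rewrite setTI; apply: sub_sigma_algebra; exact: Gf.
have := mf measurableT B mB.
by rewrite setTI measurable_g_measurableTypeE.
Qed.

Lemma sigma_algebra_measurable_setT :
  sigma_algebra [set: Om] (@measurable d Om).
Proof. exact: sigma_algebra_measurable. Qed.

Lemma bmeas_sub G G' f : G `<=` G' -> bmeas G f -> bmeas G' f.
Proof. by move=> GG' [Gf bf]; split=> // B mB; exact/GG'/Gf. Qed.

Lemma bmeas_cst G r : sigma_algebra setT G -> bmeas G (fun=> r).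
Proof.
move=> sG; split; last by exists `|r|.
by apply/Gmeas_measurable_fun => //; exact: measurable_cst.
Qed.

Lemma bmeasD G f g : sigma_algebra setT G -> bmeas G f -> bmeas G g ->
  bmeas G (fun w => f w + g w).
Proof.
move=> sG [/(Gmeas_measurable_fun _ _ sG) mf [M fM]]
  [/(Gmeas_measurable_fun _ _ sG) mg [N gN]]; split.
  by apply/Gmeas_measurable_fun => //; exact: measurable_funD.
by exists (M + N) => w; rewrite (le_trans (ler_normD _ _))// lerD.
Qed.

Lemma bmeasM G f g : sigma_algebra setT G -> bmeas G f -> bmeas G g ->
  bmeas G (fun w => f w * g w).
Proof.
move=> sG [/(Gmeas_measurable_fun _ _ sG) mf [M fM]]
  [/(Gmeas_measurable_fun _ _ sG) mg [N gN]]; split.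
  by apply/Gmeas_measurable_fun => //; exact: measurable_funM.
by exists (M * N) => w; rewrite normrM ler_pM.
Qed.

Lemma bmeasN G f : sigma_algebra setT G -> bmeas G f ->
  bmeas G (fun w => - f w).
Proof.
move=> sG bf; under eq_fun => w do rewrite -[- f w]mulN1r.
by apply: bmeasM => //; exact: bmeas_cst.
Qed.

Lemma bmeas_sum G (I : Type) (r : seq I) (p : pred I) (f : I -> Om -> R) :
  sigma_algebra setT G -> (forall i, p i -> bmeas G (f i)) ->
  bmeas G (fun w => \sum_(i <- r | p i) f i w).
Proof.
move=> sG bf; elim: r => [|i r IH].
  by under eq_fun do rewrite big_nil; exact: bmeas_cst.
under eq_fun do rewrite big_cons.
case pi: (p i); last exact: IH.
by apply: bmeasD => //; exact: bf.
Qed.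

Lemma bmeas_expR G f : sigma_algebra setT G -> bmeas G f ->
  bmeas G (fun w => expR (f w)).
Proof.
move=> sG [/(Gmeas_measurable_fun _ _ sG) mf [M fM]]; split.
  by apply/Gmeas_measurable_fun => //; exact: measurableT_comp mf.
exists (expR M) => w; rewrite ger0_norm ?expR_ge0// ler_expR.
exact: le_trans (ler_norm _) (fM w).
Qed.

Lemma bmeas_indic G (B : set Om) : sigma_algebra setT G -> G B ->
  bmeas G (\1_B : Om -> R).
Proof.
move=> sG GB; split; last first.
  by exists 1 => w; rewrite indicE; case: (_ \in _); rewrite ?normr1 ?normr0.
apply/Gmeas_measurable_fun => //.
apply: (@measurable_indic _ (g_sigma_algebraType G)).
exact: sub_sigma_algebra.
Qed.

Lemma bmeas_range01 G f : Gmeas G f -> (forall w, 0 <= f w <= 1) ->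
  bmeas G f.
Proof.
move=> Gf f01; split=> //; exists 1 => w.
by have /andP[f0 f1] := f01 w; rewrite ger0_norm.
Qed.

Variable P : probability Om R.

Notation bm := (bmeas measurable).
Let sM := sigma_algebra_measurable_setT.

Lemma bmeas_integrable f (D : set Om) : measurable D -> bm f ->
  P.-integrable D (EFin \o f).
Proof.
move=> mD [mf [M fM]]; apply: measurable_bounded_integrable => //.
- by rewrite (le_lt_trans (probability_le1 P mD))// ltry.
- apply: measurable_funTS => _ B mB; rewrite setTI; exact: mf.
- exists M; split; first exact: num_real.
  by move=> x Mx w _; rewrite /= (le_trans (fM w))// ltW.
Qed.

Lemma le_Eb f g : bm f -> bm g -> (forall w, f w <= g w) ->
  \int[P]_w f w <= \int[P]_w g w.
Proof.
by move=> bf bg fg; apply: le_Rintegral => //; exact: bmeas_integrable.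
Qed.

Lemma EbD f g : bm f -> bm g ->
  \int[P]_w (f w + g w) = \int[P]_w f w + \int[P]_w g w.
Proof.
by move=> bf bg; rewrite RintegralD//; exact: bmeas_integrable.
Qed.

Lemma EbZ r f : bm f -> \int[P]_w (r * f w) = r * \int[P]_w f w.
Proof.
by move=> bf; rewrite RintegralZl//; exact: bmeas_integrable.
Qed.

Lemma Eb_cst r : \int[P]_w (cst r w) = r.
Proof. by rewrite Rintegral_cst//= probability_setT mulr1. Qed.

Lemma Eb_sum (I : Type) (s : seq I) (p : pred I) (f : I -> Om -> R) :
  (forall i, p i -> bm (f i)) ->
  \int[P]_w (\sum_(i <- s | p i) f i w) =
  \sum_(i <- s | p i) \int[P]_w f i w.
Proof.
move=> bf; elim: s => [|i s IH].
  rewrite big_nil; under eq_Rintegral do rewrite big_nil.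
  exact: Eb_cst.
rewrite big_cons; under eq_Rintegral do rewrite big_cons.
case pi: (p i); rewrite ?IH// EbD ?IH//; first exact: bf.
exact: bmeas_sum.
Qed.

Lemma Eb_indicM (B : set Om) f : measurable B ->
  \int[P]_w (\1_B w * f w) = \int[P]_(w in B) f w.
Proof.
move=> mB; rewrite [RHS]Rintegral_mkcond; apply: eq_Rintegral => w _.
by rewrite patchE indicE; case: ifP; rewrite ?mul1r ?mul0r.
Qed.

(** * Replacing a variable by one with the same conditional mean *)

Section Swap.
Variables (G : set (set Om)) (sG : sigma_algebra setT G).
Hypothesis GM : G `<=` measurable.

(** Slice the range of [g] into intervals of length [e]. The step function [s] below [g] is constant
    on preimages in [G], where [phi] and [psi] have equal integrals; replacing [g] by [s] costs at
    most [e] times the mean of [phi]. *)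
Let swap_le (phi psi g : Om -> R) : bm phi -> bm psi ->
  (forall w, 0 <= phi w) -> (forall w, 0 <= psi w) ->
  (forall B, G B -> \int[P]_(w in B) phi w = \int[P]_(w in B) psi w) ->
  bmeas G g -> (forall w, 0 <= g w) ->
  \int[P]_w (g w * phi w) <= \int[P]_w (g w * psi w).
Proof.
move=> bphi bpsi phi0 psi0 EB bg g0.
have bgM : bm g by exact: bmeas_sub bg.
pose C := \int[P]_w phi w.
have C0 : 0 <= C by exact: Rintegral_ge0.
suff H e : 0 < e -> \int[P]_w (g w * phi w) <= \int[P]_w (g w * psi w) + e * C.
  apply/ler_addgt0Pl => e e0.
  (* The mesh is divided by [C + 1] because [C] may vanish. *)
  have C1 : 0 < C + 1 by rewrite ltr_wpDl.
  have := H (e / (C + 1)) (divr_gt0 e0 C1).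
  move=> /le_trans; apply; rewrite addrC lerD2r.
  by rewrite mulrAC ler_pdivrMr// mulrDr mulr1 lerDl ltW.
move=> e0; have [Gg [M gM]] := bg.
pose A k := g @^-1` `[k%:R * e, k.+1%:R * e[%classic.
have GA k : G (A k) by apply: Gg; exact: measurable_itv.
(* With this many slices the last one reaches beyond the bound [M] of [g]. *)
pose N := (Num.truncn (M / e)).+1.
pose s w := \sum_(k < N) k%:R * e * \1_(A k) w.
have bs : bmeas G s.
  apply: bmeas_sum => // k _; apply: bmeasM => //; first exact: bmeas_cst.
  exact: bmeas_indic.
have bsM : bm s by exact: bmeas_sub bs.
have sg w : s w <= g w <= s w + e.
  pose k := Num.truncn (g w / e).
  have ge0 : 0 <= g w / e by rewrite divr_ge0// ltW.
  have /andP[k1 k2] := truncn_itv ge0; rewrite -/k in k1 k2.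
  have kN : (k < N)%N.
    rewrite ltnS; apply: le_truncn; rewrite ler_pM2r ?invr_gt0//.
    by have := gM w; rewrite ger0_norm.
  have Ak j : (j < N)%N -> (w \in A j) = (j == k).
    move=> _; apply/idP/eqP => [|->].
      rewrite inE /A /= in_itv/= -ler_pdivlMr// -ltr_pdivrMr// => jk.
      by rewrite /k (truncn_def jk).
    rewrite inE /A /= in_itv/= -ler_pdivlMr// -ltr_pdivrMr// k1 k2 //.
  have -> : s w = k%:R * e.
    rewrite /s (bigD1 (Ordinal kN))//= indicE Ak// eqxx mulr1 big1 ?addr0//.
    move=> j /negP jk; rewrite indicE Ak//.
    case: eqP => [jk'|]; last by rewrite mulr0.
    by exfalso; apply: jk; apply/eqP/val_inj.
  rewrite -ler_pdivlMr// k1/=.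
  by rewrite -[e in _ + e]mul1r -mulrDl natr1 -ler_pdivrMr// ltW.
have sE f : bm f ->
    \int[P]_w (s w * f w) = \sum_(k < N) k%:R * e * \int[P]_(w in A k) f w.
  move=> bf; under eq_Rintegral do rewrite /s mulr_suml.
  rewrite Eb_sum; last first.
    move=> k _; apply: bmeasM => //; apply: bmeasM => //.
      exact: bmeas_cst.
    exact/bmeas_indic/GM.
  apply: eq_bigr => k _; under eq_Rintegral do rewrite -mulrA.
  rewrite EbZ; last by apply: bmeasM => //; exact/bmeas_indic/GM.
  by rewrite Eb_indicM//; exact: GM.
apply: (@le_trans _ _ (\int[P]_w (s w * phi w + e * phi w))).
  apply: le_Eb => [| |w]; first exact: bmeasM.
    by apply: bmeasD => //; apply: bmeasM => //; exact: bmeas_cst.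
  by rewrite -mulrDl ler_wpM2r//; case/andP: (sg w).
rewrite EbD; [|exact: bmeasM|by apply: bmeasM => //; exact: bmeas_cst].
rewrite EbZ// lerD2r sE// (eq_bigr (fun k : 'I_N =>
  k%:R * e * \int[P]_(w in A k) psi w)); last by move=> k _; rewrite EB.
rewrite -sE//; apply: le_Eb => [| |w]; [exact: bmeasM|exact: bmeasM|].
by rewrite ler_wpM2r//; case/andP: (sg w).
Qed.

(** Equal integrals over all events of [G] say that [phi] and [psi] have the same conditional
    expectation given [G]. Adding the constant [M + N] makes both nonnegative, and [swap_le] then
    applies in both directions. *)
Lemma Eb_swap (phi psi g : Om -> R) : bm phi -> bm psi ->
  (forall B, G B -> \int[P]_(w in B) phi w = \int[P]_(w in B) psi w) ->
  bmeas G g -> (forall w, 0 <= g w) ->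
  \int[P]_w (g w * phi w) = \int[P]_w (g w * psi w).
Proof.
move=> bphi bpsi EB bg g0.
have bgM : bm g by exact: bmeas_sub bg.
have [M phiM] := bphi.2; have [N psiN] := bpsi.2.
have bc r : bm (fun=> r) by exact: bmeas_cst.
have shift f : bm f -> \int[P]_w (g w * (f w + (M + N))) =
    \int[P]_w (g w * f w) + \int[P]_w (g w * (M + N)).
  move=> bf; under eq_Rintegral do rewrite mulrDr.
  by rewrite EbD//; exact: bmeasM.
have [M0 N0] : 0 <= M /\ 0 <= N.
  by split; [have := phiM point|have := psiN point]; exact: le_trans.
have lb (f : Om -> R) K : (forall w, `|f w| <= K) -> K <= M + N ->
    forall w, 0 <= f w + (M + N).
  move=> fK KMN w; have := fK w; rewrite ler_norml => /andP[].
  by move=> /(le_trans _) fw _; rewrite -lerBlDr sub0r fw// lerN2.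
have pM := lb _ _ phiM ltac:(by rewrite lerDl).
have pN := lb _ _ psiN ltac:(by rewrite lerDr).
have bpM : bm (fun w => phi w + (M + N)) by exact: bmeasD.
have bpN : bm (fun w => psi w + (M + N)) by exact: bmeasD.
apply: (addIr (\int[P]_w (g w * (M + N)))); rewrite -!shift//.
have EB' B : G B -> \int[P]_(w in B) (phi w + (M + N)) =
    \int[P]_(w in B) (psi w + (M + N)).
  move=> GB; have mB := GM _ GB.
  by rewrite !RintegralD ?EB//; exact: bmeas_integrable.
by apply/eqP; rewrite eq_le !swap_le// => B /EB'.
Qed.

(** One step of an exponential supermartingale. Given [G], the weights [b] are known, so each
    [phi i] may be replaced by its conditional surrogate [psi i]; then [1 + Z <= expR Z] cancels the
    factor [expR (- Z)]. *)
Lemma Eb_expR_le (g Z D : Om -> R) (I : finType) (p : pred I)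
    (b phi psi : I -> Om -> R) :
  bmeas G g -> (forall w, 0 <= g w) -> bmeas G Z -> bm D ->
  (forall i, p i -> bmeas G (b i)) -> (forall i w, p i -> 0 <= b i w) ->
  (forall i, p i -> bm (phi i)) -> (forall i, p i -> bm (psi i)) ->
  (forall i B, p i -> G B ->
    \int[P]_(w in B) phi i w = \int[P]_(w in B) psi i w) ->
  (forall w, expR (D w) <=
    expR (- Z w) * (1 + \sum_(i | p i) b i w * phi i w)) ->
  (forall w, \sum_(i | p i) b i w * psi i w <= Z w) ->
  \int[P]_w (g w * expR (D w)) <= \int[P]_w g w.
Proof.
move=> bg g0 bZ bD bb b0 bphi bpsi EB De Ze.
pose h w := g w * expR (- Z w).
have bh : bmeas G h by apply: bmeasM => //; exact/bmeas_expR/bmeasN.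
have h0 w : 0 <= h w by rewrite mulr_ge0// expR_ge0.
have bgM : bm g by exact: bmeas_sub bg.
have bhM : bm h by exact: bmeas_sub bh.
have bbM i : p i -> bm (b i) by move=> pi; exact: bmeas_sub (bb i pi).
have bS (f : I -> Om -> R) : (forall i, p i -> bm (f i)) ->
    bm (fun w => 1 + \sum_(i | p i) b i w * f i w).
  move=> bf; apply: bmeasD => //; first exact: bmeas_cst.
  apply: bmeas_sum => // i pi.
  by apply: bmeasM => //; [exact: bbM|exact: bf].
have bhb i : p i -> bmeas G (fun w => h w * b i w).
  by move=> pi; apply: bmeasM => //; exact: bb.
have bhbM i : p i -> bm (fun w => h w * b i w).
  by move=> pi; exact: bmeas_sub (bhb i pi).
have expand (f : I -> Om -> R) : (forall i, p i -> bm (f i)) ->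
    \int[P]_w (h w * (1 + \sum_(i | p i) b i w * f i w)) =
    \int[P]_w h w + \sum_(i | p i) \int[P]_w (h w * b i w * f i w).
  move=> bf; rewrite -Eb_sum; last first.
    by move=> i pi; apply: bmeasM => //; [exact: bhbM|exact: bf].
  rewrite -EbD//; last first.
    apply: bmeas_sum => // i pi.
    by apply: bmeasM => //; [exact: bhbM|exact: bf].
  apply: eq_Rintegral => w _; rewrite mulrDr mulr1 mulr_sumr.
  by under eq_bigr do rewrite mulrA.
apply: (@le_trans _ _
    (\int[P]_w (h w * (1 + \sum_(i | p i) b i w * phi i w)))).
  apply: le_Eb => [| |w].
  - by apply: bmeasM => //; exact: bmeas_expR.
  - by apply: bmeasM => //; exact: bS.
  - by rewrite /h -mulrA ler_wpM2l.
rewrite expand// (eq_bigr (fun i => \int[P]_w (h w * b i w * psi i w))).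
  rewrite -expand//; apply: le_Eb => // [|w].
    by apply: bmeasM => //; exact: bS.
  rewrite /h -mulrA -[leRHS]mulr1 ler_wpM2l//.
  rewrite expRN ler_pdivrMl ?expR_gt0// mulr1.
  apply: le_trans (expR_ge1Dx _); by rewrite lerD2l.
move=> i pi; apply: Eb_swap => //.
- exact: bphi.
- exact: bpsi.
- by move=> B GB; exact: EB.
- exact: bhb.
- by move=> w; rewrite mulr_ge0// b0.
Qed.

End Swap.

(** * Tail bound for exponential supermartingales *)

(** Taking for [g] the exponential of the previous partial sum shows by induction that the
    exponential of the full sum has mean at most 1; Markov's inequality concludes. *)
Lemma supermartingale_tail (T : nat) (F : nat -> set (set Om))
  (D : nat -> Om -> R) (i : R) : filtration T F ->
  (forall t, (1 <= t <= T)%N -> bmeas (F t) (D t)) ->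
  (forall t g, (1 <= t <= T)%N -> bmeas (F t.-1) g -> (forall w, 0 <= g w) ->
    \int[P]_w (g w * expR (D t w)) <= \int[P]_w g w) ->
  let A := [set w | i < \sum_(1 <= t < T.+1) D t w] in
  measurable A /\ (P A <= (expR (- i))%:E)%E.
Proof.
move=> [Fsig Fmono] bD ED A.
pose S t w := \sum_(1 <= s < t.+1) D s w.
have SS t w : S t.+1 w = S t w + D t.+1 w by rewrite /S big_nat_recr.
have bS t : (t <= T)%N -> bmeas (F t) (S t).
  elim: t => [|t IH] tT.
    rewrite /S; under eq_fun do rewrite big_geq//.
    by apply: bmeas_cst; case: (Fsig 0%N).
  have [sF _] := Fsig t.+1 tT.
  rewrite (_ : S t.+1 = fun w => S t w + D t.+1 w); last exact/funext.
  apply: bmeasD => //; last by apply: bD.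
  by apply: bmeas_sub (IH (ltnW tT)); apply: Fmono.
have FM t : (t <= T)%N -> F t `<=` measurable by move=> /Fsig[].
have bW t : (t <= T)%N -> bmeas (F t) (fun w => expR (S t w)).
  by move=> tT; apply: bmeas_expR; [case: (Fsig t tT)|exact: bS].
have EW t : (t <= T)%N -> \int[P]_w expR (S t w) <= 1.
  elim: t => [|t IH] tT.
    rewrite /S; under eq_Rintegral do rewrite big_geq// expR0.
    by rewrite Eb_cst.
  apply: le_trans (IH (ltnW tT)).
  under eq_Rintegral do rewrite SS expRD.
  apply: ED => //; by apply: bW; exact: ltnW.
have bST := bmeas_sub _ _ _ (FM T (leqnn T)) (bS T (leqnn T)).
have bWT := bmeas_sub _ _ _ (FM T (leqnn T)) (bW T (leqnn T)).
have mA : measurable A.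
  have -> : A = S T @^-1` `]i, +oo[%classic.
    by apply/seteqP; split => w; rewrite /A /= in_itv/= andbT.
  exact: (bST.1 _ (measurable_itv _)).
split=> //.
(* Markov: [expR i] times the indicator of [A] is at most [expR (S T w)]. *)
have : expR i * fine (P A) <= 1.
  apply: le_trans (EW T (leqnn T)).
  rewrite -[fine (P A)]mul1r -(Rintegral_cst _ mA) -(Eb_indicM _ _ mA)/=.
  have bA := bmeas_indic _ _ sM mA.
  rewrite -EbZ; last by apply: bmeasM => //; exact: bmeas_cst.
  apply: le_Eb => // [|w].
    by do ![apply: bmeasM => //; try exact: bmeas_cst].
  rewrite indicE; case: (boolP (w \in A)); last by rewrite mul0r mulr0 expR_ge0.
  rewrite inE /A/= => iS; rewrite !mulr1 ler_expR; exact: ltW.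
rewrite -[P A]fineK ?fin_num_measure// lee_fin expRN.
by rewrite -ler_pdivlMl ?expR_gt0// mulr1.
Qed.

End BoundedMeasurable.

(** * Two elementary inequalities *)

(** The quotient [f] of the right side by [expR] has derivative [y (1 - y) expR (- y)], which is
    negative for [y < 0] and nonnegative on [[0, 1]]. So [f] is minimal at 0 among [y <= 1], with
    [f 0 = 1]. *)
Lemma expR_le1DxD2 {R : realType} (x : R) : x <= 1 ->
  expR x <= 1 + x + x ^+ 2.
Proof.
move=> x1.
pose f (y : R) := (1 + y + y ^+ 2) * expR (- y).
pose df (y : R) := y * (1 - y) * expR (- y).
have fd (y : R) : is_derive y (1 : R) f (df y).
  rewrite /f; apply: is_derive_eq.
  by rewrite /df !scaler1 /GRing.scale /=; ring.
have fc (a b : R) : {within `[a, b], continuous f}.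
  by apply: derivable_within_continuous => y _; exact: ex_derive.
suff : 1 <= f x.
  by rewrite /f expRN -ler_pdivrMr ?invr_gt0 ?expR_gt0// invrK mul1r.
have f0 : f 0 = 1 by rewrite /f oppr0 expR0; ring.
rewrite -f0 -subr_ge0.
have [x0|x0] := leP 0 x.
  have [c /[!in_itv]/= /andP[c0 cx] ->] :=
    MVT_segment x0 (fun y _ => fd y) (fc _ _).
  rewrite subr0 /df !mulr_ge0 ?expR_ge0 ?subr_ge0//; exact: le_trans x1.
have [c /[!in_itv]/= /andP[cx c0] e] :=
  MVT_segment (ltW x0) (fun y _ => fd y) (fc _ _).
rewrite -opprB e sub0r /df -mulrN opprK mulrAC mulr_ge0 ?expR_ge0//.
by rewrite mulrAC mulr_ge0 ?mulr_le0 ?subr_ge0 ?(le_trans c0)// ltW.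
Qed.

Lemma sqr_sum_le {R : realFieldType} (n : nat) (u : nat -> R) :
  (\sum_(1 <= h < n.+1) u h) ^+ 2 <= n%:R * \sum_(1 <= h < n.+1) u h ^+ 2.
Proof.
elim: n => [|n IH]; first by rewrite !big_geq// expr0n mul0r.
rewrite !(big_nat_recr n.+1)//= -natr1.
set s := \sum_(_ <= _ < _) _ in IH *.
set q := \sum_(_ <= _ < _) _ in IH *.
set v := u _.
have q0 : 0 <= q by apply: sumr_ge0 => i _; rewrite sqr_ge0.
have [n0|n0] := posnP n.
  have s0 : s = 0 by rewrite /s n0 big_geq.
  by rewrite s0 n0 add0r add0r mul1r lerDr.
have n0' : 0 < n%:R :> R by rewrite ltr0n.
rewrite -subr_ge0 -(pmulr_rge0 _ n0').
(* The goal is the nonnegativity of [(n + 1) (n q - s^2) + (s - n v)^2]. *)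
have : 0 <= (s - n%:R * v) ^+ 2 by exact: sqr_ge0.
set N := n%:R in IH n0' *; nra.
Qed.

(** * Realization plans, [kappa] and visited pairs *)

Section Game.
Context {R : realType} {X Act : finType} {H : nat} {depth : X -> nat}
  {Aset : X -> {set Act}} {par : X -> option (X * Act)}.
Hypothesis Hgame : game_wf H depth Aset par.

Lemma policy_itv (mu : X -> Act -> R) x a : is_policy Aset mu ->
  a \in Aset x -> 0 <= mu x a <= 1.
Proof.
move=> pmu ax; have [mu0 mu1] := pmu x.
rewrite mu0//= -mu1 (bigD1 a)//= lerDl sumr_ge0// => b /andP[bx _].
exact: mu0.
Qed.

Lemma rplan_itv (mu : X -> Act -> R) x a : is_policy Aset mu ->
  a \in Aset x -> 0 <= rplan H par mu x a <= 1.
Proof.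
move=> pmu; rewrite /rplan; elim: H x a => [|n IH] x a ax /=.
  exact: policy_itv.
have /andP[m0 m1] := policy_itv _ _ _ pmu ax.
have [_ _ _ /(_ x)] := Hgame; case: (par x) => [[y b]|_]; last first.
  by rewrite mulr1 m0.
move=> [_ /IH /andP[r0 r1]]; by rewrite mulr_ge0//= mulr_ile1.
Qed.

Lemma rplan_gt0 (mu : X -> Act -> R) x a : positive_policy Aset mu ->
  a \in Aset x -> 0 < rplan H par mu x a.
Proof.
move=> [_ mu0]; rewrite /rplan; elim: H x a => [|n IH] x a ax /=.
  exact: mu0.
have [_ _ _ /(_ x)] := Hgame; case: (par x) => [[y b]|_]; last first.
  by rewrite mulr1 mu0.
by move=> [_ /IH r0]; rewrite mulr_gt0// mu0.
Qed.

Variable mus : X -> Act -> R.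
Hypothesis Hmus : positive_policy Aset mus.
Let q := rplan H par mus.

(** A [sup] bounds its set only if the set is bounded above: realization plans are at most 1, so the
    sum of all [1 / q] is an upper bound. *)
Lemma kappa_ge (mu : X -> Act -> R) : is_policy Aset mu ->
  \sum_x \sum_(a in Aset x) rplan H par mu x a / q x a <=
  kappa H Aset par mus.
Proof.
move=> pmu; apply: ub_le_sup; last by exists mu.
exists (\sum_x \sum_(a in Aset x) (q x a)^-1) => _ [nu [pnu ->]].
apply: ler_sum => x _; apply: ler_sum => a ax.
have /andP[_ r1] := rplan_itv nu x a pnu ax.
by rewrite -[leRHS]mul1r ler_wpM2r// invr_ge0 ltW// rplan_gt0.
Qed.

(** The sampling policy competes in [kappa] and its ratios are positive; [x] ensures that there is
    at least one. *)
Lemma kappa_gt0 (x : X) : 0 < kappa H Aset par mus.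
Proof.
apply: lt_le_trans (kappa_ge mus Hmus.1).
have t0 y a : a \in Aset y -> 0 < q y a / q y a.
  by move=> ay; rewrite divr_gt0// rplan_gt0.
have [_ _ /(_ x)/card_gt0P[a ax] _] := Hgame.
rewrite (bigD1 x)//= (bigD1 a)//= ltr_pwDl//.
  by rewrite ltr_wpDr ?t0// sumr_ge0// => b /andP[bx _]; rewrite ltW// t0.
by rewrite sumr_ge0// => y _; rewrite sumr_ge0// => b by_; rewrite ltW// t0.
Qed.

(** A trajectory visits exactly one pair at each depth. A sum over [h] is inserted, in which only
    [h = depth x] contributes because [xs h] has depth [h]. *)
Lemma sum_visited (xs : nat -> X) (acts : nat -> Act) (f : X -> Act -> R) :
  (forall h, (1 <= h <= H)%N ->
     depth (xs h) = h /\ acts h \in Aset (xs h)) ->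
  \sum_x \sum_(a in Aset x)
    (if (xs (depth x) == x) && (acts (depth x) == a) then f x a else 0) =
  \sum_(1 <= h < H.+1) f (xs h) (acts h).
Proof.
move=> traj; have [_ dep _ _] := Hgame.
transitivity (\sum_(1 <= h < H.+1) \sum_x \sum_(a in Aset x)
    (if (xs h == x) && (acts h == a) then f x a else 0)).
  rewrite exchange_big/=; apply: eq_bigr => x _.
  rewrite exchange_big/=; apply: eq_bigr => a ax.
  rewrite (bigD1_seq (depth x)) ?iota_uniq//=; last first.
    by rewrite mem_index_iota; exact: dep.
  rewrite big_seq_cond big1 ?addr0// => h /andP[].
  rewrite mem_index_iota => hH /eqP hx; case: eqP => //= xhx.
  by case: hx; rewrite -xhx; have [->] := traj h hH.
rewrite big_nat [RHS]big_nat; apply: eq_bigr => h /traj[_ ax].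
rewrite (bigD1 (xs h))//= (bigD1 (acts h))//= !eqxx/=.
rewrite big1 ?addr0 => [|b /andP[_ /negPf bn]]; last first.
  by rewrite [_ == b]eq_sym bn.
rewrite big1 ?addr0// => y /negPf yx; rewrite big1// => b _.
by rewrite eq_sym yx.
Qed.

(** * Regret against estimated regret along one fixed outcome *)

Section Deterministic.
Variables (T : nat) (xs : nat -> nat -> X) (acts : nat -> nat -> Act)
  (ls : nat -> nat -> R).
Hypothesis traj : forall t h, (1 <= t <= T)%N -> (1 <= h <= H)%N ->
  [/\ depth (xs t h) = h, acts t h \in Aset (xs t h) & 0 <= ls t h <= 1].
Let lhat t x a := if (xs t (depth x) == x) && (acts t (depth x) == a)
  then ls t (depth x) / q x a else 0.

Lemma lhat_ge0 t x a : (1 <= t <= T)%N -> a \in Aset x -> 0 <= lhat t x a.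
Proof.
move=> tT ax; rewrite /lhat; case: ifP => // _.
have [_ dep _ _] := Hgame.
have [_ _ /andP[l0 _]] := traj t _ tT (dep x).
by rewrite divr_ge0// ltW// rplan_gt0.
Qed.

Lemma inner_lhatE t (r : X -> Act -> R) : (1 <= t <= T)%N ->
  inner Aset (lhat t) r = \sum_(1 <= h < H.+1)
    ls t h * (r (xs t h) (acts t h) / q (xs t h) (acts t h)).
Proof.
move=> tT; rewrite /inner.
rewrite (eq_bigr (fun x => \sum_(a in Aset x)
    if (xs t (depth x) == x) && (acts t (depth x) == a)
    then ls t (depth x) * (r x a / q x a) else 0)).
  rewrite sum_visited => [|h hH]; last by have [] := traj t h tT hH.
  rewrite big_nat [RHS]big_nat; apply: eq_bigr => h hH.
  by have [-> _ _] := traj t h tT hH.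
move=> x _; apply: eq_bigr => a _; rewrite /lhat; case: ifP; rewrite ?mul0r//.
by rewrite mulrAC mulrA.
Qed.

(** Against the sampling policy the importance weights cancel, leaving [H] losses, each at most
    1. *)
Lemma inner_lhat_sampling t : (1 <= t <= T)%N ->
  inner Aset (lhat t) q <= H%:R.
Proof.
move=> tT; rewrite inner_lhatE//.
rewrite -[H in H%:R]subn0 -(@subSS 0) -sumr_const_nat big_nat [leRHS]big_nat.
apply: ler_sum => h hH; have [_ ax /andP[_ l1]] := traj t h tT hH.
by rewrite divff ?mulr1// gt_eqF// rplan_gt0.
Qed.

(** Cauchy-Schwarz over the [H] depths, then losses and realization plans are at most 1. The bound
    is linear in the visit indicators, so its conditional mean can be computed pair by pair. *)
Lemma inner_lhat_sqr t (mu : X -> Act -> R) : (1 <= t <= T)%N ->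
  is_policy Aset mu ->
  inner Aset (lhat t) (rplan H par mu) ^+ 2 <=
  H%:R * \sum_x \sum_(a in Aset x)
    if (xs t (depth x) == x) && (acts t (depth x) == a)
    then rplan H par mu x a / q x a ^+ 2 else 0.
Proof.
move=> tT pmu; rewrite inner_lhatE//; apply: le_trans (sqr_sum_le _ _) _.
rewrite ler_wpM2l//.
rewrite sum_visited => [|h hH]; last by have [] := traj t h tT hH.
rewrite big_nat [leRHS]big_nat.
apply: ler_sum => h hH; have [_ ax /andP[l0 l1]] := traj t h tT hH.
have q0 := rplan_gt0 _ _ _ Hmus ax.
have /andP[r0 r1] := rplan_itv _ _ _ pmu ax.
rewrite exprMn expr_div_n mulrA ler_wpM2r ?invr_ge0 ?sqr_ge0//.
rewrite -[leRHS]mul1r; apply: ler_pM => //; rewrite ?sqr_ge0//.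
  by rewrite expr_le1.
by rewrite expr2 ler_piMr.
Qed.

(** The part of the argument without probability. The last two premises are the two concentration
    bounds, with [g * k] as the multiplier [c]; the term [S / (k * q x a)] is [iota / (c * q x a)]
    when [iota = g * S]. *)
Lemma regret_le_estimated (l : nat -> X -> Act -> R)
  (mu : nat -> X -> Act -> R) (g k : R) :
  (forall t x a, (1 <= t <= T)%N -> a \in Aset x -> 0 <= l t x a) ->
  (forall t, (1 <= t <= T)%N -> is_policy Aset (mu t)) ->
  0 < g -> 0 < k -> kappa H Aset par mus <= k ->
  let S := g * k * (H%:R * T%:R) in
  \sum_(1 <= t < T.+1) (inner Aset (l t) (rplan H par (mu t))
     - inner Aset (lhat t) (rplan H par (mu t))) <= 2 * S ->
  (g * k <= 1 -> forall x a, a \in Aset x ->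
     \sum_(1 <= t < T.+1) (lhat t x a - l t x a) <=
     g * k * (\sum_(1 <= t < T.+1) l t x a) + S / (k * q x a)) ->
  regret T H Aset par l mu <=
  Num.max (regret T H Aset par lhat mu) 0 + 4 * S.
Proof.
move=> l0 pmu g0 k0 kk S dev lhat_dev.
have S0 : 0 <= S by rewrite !mulr_ge0// ltW.
have [pmus _] := Hmus.
have innerB (f : nat -> X -> Act -> R) mud :
    \sum_(1 <= t < T.+1) inner Aset (f t) (fun x a =>
       rplan H par (mu t) x a - rplan H par mud x a) =
    \sum_(1 <= t < T.+1) inner Aset (f t) (rplan H par (mu t)) -
    \sum_(1 <= t < T.+1) inner Aset (f t) (rplan H par mud).
  rewrite -sumrB; apply: eq_bigr => t _; rewrite /inner -sumrB.
  apply: eq_bigr => x _; rewrite -sumrB; apply: eq_bigr => a _.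
  by rewrite mulrBr.
have inner_ge0 (f : nat -> X -> Act -> R) nu t : (1 <= t <= T)%N ->
    (forall t x a, (1 <= t <= T)%N -> a \in Aset x -> 0 <= f t x a) ->
    is_policy Aset nu -> 0 <= inner Aset (f t) (rplan H par nu).
  move=> tT f0 pnu; rewrite /inner; apply: sumr_ge0 => x _.
  apply: sumr_ge0 => a ax; rewrite mulr_ge0 ?f0//.
  by case/andP: (rplan_itv nu x a pnu ax).
have sum_inner_ge0 (f : nat -> X -> Act -> R) nu :
    (forall t x a, (1 <= t <= T)%N -> a \in Aset x -> 0 <= f t x a) ->
    is_policy Aset nu ->
    0 <= \sum_(1 <= t < T.+1) inner Aset (f t) (rplan H par nu).
  move=> f0 pnu; rewrite big_nat; apply: sumr_ge0 => t tT.
  exact: inner_ge0.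
pose M f := \sum_(1 <= t < T.+1) inner Aset (f t) (rplan H par (mu t)).
have devM : M l <= M lhat + 2 * S.
  by rewrite -lerBlDl /M -sumrB.
have rhat_ge mud : is_policy Aset mud -> M lhat -
    \sum_(1 <= t < T.+1) inner Aset (lhat t) (rplan H par mud) <=
    Num.max (regret T H Aset par lhat mu) 0.
  move=> pmud; rewrite le_max -innerB; apply/orP; left.
  apply: ub_le_sup; last by exists mud.
  (* Estimated losses are nonnegative, so dropping the comparator's loss bounds the set under the
     [sup]. *)
  exists (M lhat) => _ [nu [pnu ->]]; rewrite innerB lerBlDr lerDl.
  by apply: sum_inner_ge0 => // *; exact: lhat_ge0.
have rhat_sampling : M lhat - H%:R * T%:R <=
    Num.max (regret T H Aset par lhat mu) 0.
  apply: le_trans (rhat_ge mus pmus); rewrite lerD2l lerN2.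
  rewrite mulr_natr -[T in leRHS]subn0 -(@subSS 0) -sumr_const_nat.
  rewrite big_nat [leRHS]big_nat; apply: ler_sum => t.
  exact: inner_lhat_sampling.
apply: ge_sup; first by exists (\sum_(1 <= t < T.+1) inner Aset (l t)
  (fun x a => rplan H par (mu t) x a - rplan H par mus x a)), mus.
move=> _ [mud [pmud ->]]; rewrite innerB -/(M l).
set L := \sum_(_ <= _ < _) inner _ (l _) _.
have L0 : 0 <= L by exact: sum_inner_ge0.
(* If the comparator loses at least [H T], then [M l - L <= M lhat + 2 S - H T], and [rhat_sampling]
   suffices. *)
have [LHT|LHT] := leP (H%:R * T%:R) L; first lra.
(* If [g * k > 1], then [H T <= S], so the cost [H T] of comparing with the sampling policy is
   absorbed. *)
have [gk1|gk1] := leP (g * k) 1; last first.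
  have : H%:R * T%:R <= S by rewrite /S ler_peMl// ?mulr_ge0// ltW.
  lra.
pose Lh := \sum_(1 <= t < T.+1) inner Aset (lhat t) (rplan H par mud).
suff : Lh - L <= 2 * S by have := rhat_ge mud pmud; rewrite -/Lh; lra.
have swap (f : nat -> X -> Act -> R) :
    \sum_(1 <= t < T.+1) inner Aset (f t) (rplan H par mud) =
    \sum_x \sum_(a in Aset x) (\sum_(1 <= t < T.+1) f t x a) *
      rplan H par mud x a.
  rewrite /inner exchange_big/=; apply: eq_bigr => x _.
  rewrite exchange_big/=; apply: eq_bigr => a _.
  by rewrite mulr_suml.
(* Weight the pairwise bounds by the comparator's realization plan; the terms in [1 / q] add up to a
   sum bounded by [kappa]. Each of the two summands is then at most [S]. *)
apply: (@le_trans _ _ (g * k * L + S / k * kappa H Aset par mus)).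
  apply: (@le_trans _ _ (g * k * L + S / k *
     \sum_x \sum_(a in Aset x) rplan H par mud x a / q x a)); last first.
    by rewrite lerD2l ler_wpM2l ?kappa_ge// divr_ge0// ltW.
  rewrite /Lh /L !swap !mulr_sumr -sumrB -big_split/=.
  apply: ler_sum => x _; rewrite !mulr_sumr -sumrB -big_split/=.
  apply: ler_sum => a ax.
  have /andP[r0 _] := rplan_itv mud x a pmud ax.
  rewrite -mulrBl -sumrB; apply: le_trans (ler_wpM2r r0 (lhat_dev gk1 x a ax)) _.
  by rewrite mulrDl mulrA invfM [in leRHS](mulrC (rplan _ _ _ _ _)) !mulrA.
have : S / k * kappa H Aset par mus <= S.
  by rewrite mulrAC ler_pdivrMr// ler_wpM2l.
have : g * k * L <= S by rewrite /S ler_wpM2l ?mulr_ge0 ?ltW.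
lra.
Qed.

End Deterministic.
End Game.

(** * Union bound *)

Lemma probability_bigsetU_le {d} {Om : measurableType d} {R : realType}
  (P : probability Om R) (I : Type) (s : seq I) (p : pred I)
  (A : I -> set Om) (e : R) :
  (forall i, p i -> measurable (A i) /\ (P (A i) <= e%:E)%E) ->
  measurable (\big[setU/set0]_(i <- s | p i) A i) /\
  (P (\big[setU/set0]_(i <- s | p i) A i) <= (\sum_(i <- s | p i) e)%:E)%E.
Proof.
move=> pA; elim: s => [|i s [mA PA]]; first by rewrite !big_nil measure0.
rewrite !big_cons; case: ifP => // pi; have [mi Pi] := pA i pi.
split; first exact: measurableU.
by rewrite EFinD (le_trans (measureU2 _ mi mA))// leeD.
Qed.

(** * Concentration of the estimated losses *)

Section Concentration.
Context {R : realType} {X Act : finType} {H : nat} {depth : X -> nat}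
  {Aset : X -> {set Act}} {par : X -> option (X * Act)}.
Hypothesis Hgame : game_wf H depth Aset par.
Variable mus : X -> Act -> R.
Hypothesis Hmus : positive_policy Aset mus.
Context {T : nat} {d : measure_display} {Om : measurableType d}.
Variables (P : probability Om R) (F : nat -> set (set Om)).
Hypothesis HF : filtration T F.
Variable mu : nat -> Om -> X -> Act -> R.
Hypothesis Hmu_pol : forall t w, (1 <= t <= T)%N -> is_policy Aset (mu t w).
Hypothesis Hmu_meas : forall t x a, (1 <= t <= T)%N ->
  Gmeas (F t.-1) (fun w => mu t w x a).
Variables (pnu : nat -> Om -> X -> R) (lnu : nat -> Om -> X -> Act -> R).
Hypothesis Hpnu : forall t w x, (1 <= t <= T)%N -> 0 <= pnu t w x <= 1.
Hypothesis Hlnu : forall t w x a, (1 <= t <= T)%N -> 0 <= lnu t w x a <= 1.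
Hypothesis Hpnu_meas : forall t x, (1 <= t <= T)%N ->
  Gmeas (F t.-1) (fun w => pnu t w x).
Hypothesis Hlnu_meas : forall t x a, (1 <= t <= T)%N ->
  Gmeas (F t.-1) (fun w => lnu t w x a).
Variables (xs : nat -> nat -> Om -> X) (acts : nat -> nat -> Om -> Act)
  (ls : nat -> nat -> Om -> R).
Hypothesis Htraj : forall t h w, (1 <= t <= T)%N -> (1 <= h <= H)%N ->
  [/\ depth (xs t h w) = h, acts t h w \in Aset (xs t h w)
    & 0 <= ls t h w <= 1].
Hypothesis Htraj_meas : forall t h, (1 <= t <= T)%N -> (1 <= h <= H)%N ->
  [/\ Gmeas_fin (F t) (xs t h), Gmeas_fin (F t) (acts t h)
    & Gmeas (F t) (ls t h)].
Let q := rplan H par mus.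
Let visit t x a := [set w | xs t (depth x) w = x /\ acts t (depth x) w = a].
Hypothesis Hcond : forall t x a B,
  (1 <= t <= T)%N -> a \in Aset x -> F t.-1 B ->
  (P (B `&` visit t x a) = \int[P]_(w in B) (pnu t w x * q x a)%:E)%E /\
  (\int[P]_(w in B `&` visit t x a) (ls t (depth x) w)%:E =
    \int[P]_(w in B) (pnu t w x * q x a * lnu t w x a)%:E)%E.

Let ltrue w t x a := pnu t w x * lnu t w x a.
Let lhat w t x a :=
  if (xs t (depth x) w == x) && (acts t (depth x) w == a)
  then ls t (depth x) w / q x a else 0.
Let kap := kappa H Aset par mus.
Let rp w t := rplan H par (mu t w).

Let F_sigma t : (1 <= t <= T)%N ->
  [/\ sigma_algebra setT (F t.-1), sigma_algebra setT (F t),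
      F t.-1 `<=` F t & F t `<=` measurable].
Proof.
case: t => // t /= tT; have [Fs Fm] := HF.
have [_ ?] := Fs t (ltnW tT); have [? ?] := Fs t.+1 tT.
by split=> //; [by have [] := Fs t (ltnW tT)|exact: Fm].
Qed.

Let visitE t x a w : (\1_(visit t x a) w : R) =
  ((xs t (depth x) w == x) && (acts t (depth x) w == a))%:R.
Proof.
rewrite indicE; congr (_%:R); congr nat_of_bool.
by apply/idP/andP; rewrite inE => -[/eqP ? /eqP ?].
Qed.

Let lhatE w t x a :
  lhat w t x a = \1_(visit t x a) w * ls t (depth x) w / q x a.
Proof.
by rewrite visitE /lhat; case: ifP; rewrite ?mul1r ?mul0r.
Qed.

Let depthH x : (1 <= depth x <= H)%N.
Proof. by have [_ dep _ _] := Hgame. Qed.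

Let F_visit t x a : (1 <= t <= T)%N -> F t (visit t x a).
Proof.
move=> tT; have [_ sF _ _] := F_sigma t tT.
have [Fx Fa _] := Htraj_meas t _ tT (depthH x).
have -> : visit t x a = xs t (depth x) @^-1` [set x] `&`
  acts t (depth x) @^-1` [set a] by [].
rewrite -(measurable_g_measurableTypeE sF); apply: measurableI.
  by rewrite measurable_g_measurableTypeE//; exact: Fx.
by rewrite measurable_g_measurableTypeE//; exact: Fa.
Qed.

Let bmeas_visit t x a : (1 <= t <= T)%N ->
  bmeas (F t) (\1_(visit t x a) : Om -> R).
Proof.
move=> tT; have [_ sF _ _] := F_sigma t tT.
by apply: bmeas_indic => //; exact: F_visit.
Qed.

Let bmeas_ls t x : (1 <= t <= T)%N -> bmeas (F t) (ls t (depth x)).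
Proof.
move=> tT; apply: bmeas_range01 => [|w].
  by have [] := Htraj_meas t _ tT (depthH x).
by have [] := Htraj t _ w tT (depthH x).
Qed.

Let bmeas_pnu t x : (1 <= t <= T)%N -> bmeas (F t.-1) (fun w => pnu t w x).
Proof.
by move=> tT; apply: bmeas_range01 => [|w]; [exact: Hpnu_meas|exact: Hpnu].
Qed.

Let bmeas_lnu t x a : (1 <= t <= T)%N ->
  bmeas (F t.-1) (fun w => lnu t w x a).
Proof.
by move=> tT; apply: bmeas_range01 => [|w]; [exact: Hlnu_meas|exact: Hlnu].
Qed.

Let bmeas_ltrue t x a : (1 <= t <= T)%N ->
  bmeas (F t.-1) (fun w => ltrue w t x a).
Proof.
move=> tT; have [sF _ _ _] := F_sigma t tT.
by apply: bmeasM => //; [exact: bmeas_pnu|exact: bmeas_lnu].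
Qed.

Let bmeas_lhat t x a : (1 <= t <= T)%N -> bmeas (F t) (fun w => lhat w t x a).
Proof.
move=> tT; have [_ sF _ _] := F_sigma t tT.
under eq_fun do rewrite lhatE.
apply: bmeasM => //; last exact: bmeas_cst.
by apply: bmeasM => //; [exact: bmeas_visit|exact: bmeas_ls].
Qed.

(** Restricted to available actions, since a policy is bounded only there; the induction stays among
    them because parent actions are available. *)
Let bmeas_rp t x a : (1 <= t <= T)%N -> a \in Aset x ->
  bmeas (F t.-1) (fun w => rp w t x a).
Proof.
move=> tT; have [sF _ _ _] := F_sigma t tT.
have bmu y b : b \in Aset y -> bmeas (F t.-1) (fun w => mu t w y b).
  move=> yb; apply: bmeas_range01 => [|w]; first exact: Hmu_meas.
  by apply: policy_itv yb; exact: Hmu_pol.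
rewrite /rp /rplan; elim: H x a => [|n IH] x a ax /=; first exact: bmu.
have [_ _ _ /(_ x)] := Hgame; case: (par x) => [[y b]|_]; last first.
  by under eq_fun do rewrite mulr1; exact: bmu.
by move=> [_ /IH ?]; apply: bmeasM => //; exact: bmu.
Qed.

Let Eb_visit t x a B : (1 <= t <= T)%N -> a \in Aset x -> F t.-1 B ->
  \int[P]_(w in B) (\1_(visit t x a) w) =
  \int[P]_(w in B) (pnu t w x * q x a).
Proof.
move=> tT ax FB; have [_ sF FF FM] := F_sigma t tT.
have mB : measurable B by exact/FM/FF.
rewrite /Rintegral -(Hcond t x a B tT ax FB).1 integral_indic// 1?setIC//.
exact/FM/F_visit.
Qed.

Let Eb_visit_loss t x a B : (1 <= t <= T)%N -> a \in Aset x -> F t.-1 B ->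
  \int[P]_(w in B) (\1_(visit t x a) w * ls t (depth x) w) =
  \int[P]_(w in B) (pnu t w x * q x a * lnu t w x a).
Proof.
move=> tT ax FB; rewrite [RHS]/Rintegral -(Hcond t x a B tT ax FB).2.
rewrite -[RHS]/(Rintegral _ _ _) [RHS]Rintegral_mkcondr.
apply: eq_Rintegral => w _; rewrite patchE indicE.
by case: ifP; rewrite ?mul1r ?mul0r.
Qed.

Let q_gt0 x a : a \in Aset x -> 0 < q x a.
Proof. exact: (rplan_gt0 Hgame mus x a Hmus). Qed.

(** The exponent [- g Y] is nonpositive, so the quadratic bound on [expR] holds for every [g >= 0].
    By [inner_lhat_sqr] and the law of the visits, the quadratic term has conditional mean at most
    [g^2 H kappa], which [D] subtracts. *)
Lemma policy_deviation_step (g : R) t (G : Om -> R) : 0 <= g ->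
  (1 <= t <= T)%N -> bmeas (F t.-1) G -> (forall w, 0 <= G w) ->
  let D w := g * (inner Aset (ltrue w t) (rp w t)
                  - inner Aset (lhat w t) (rp w t)) - g ^+ 2 * H%:R * kap in
  bmeas (F t) D /\ \int[P]_w (G w * expR (D w)) <= \int[P]_w G w.
Proof.
move=> g0 tT bG G0 D; have [sF' sF FF FM] := F_sigma t tT.
pose A (z : X * Act) := z.2 \in Aset z.1.
have innerE (f h : X -> Act -> R) :
    inner Aset f h = \sum_(z | A z) f z.1 z.2 * h z.1 z.2.
  by rewrite /inner pair_big_dep.
pose m w := inner Aset (ltrue w t) (rp w t).
pose Y w := inner Aset (lhat w t) (rp w t).
have bm : bmeas (F t.-1) m.
  rewrite /m; under eq_fun do rewrite innerE.
  apply: bmeas_sum => // z Az; apply: bmeasM => //; first exact: bmeas_ltrue.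
  exact: bmeas_rp.
have bY : bmeas (F t) Y.
  rewrite /Y; under eq_fun do rewrite innerE.
  apply: bmeas_sum => // z Az; apply: bmeasM => //; first exact: bmeas_lhat.
  by apply: bmeas_sub FF _; exact: bmeas_rp.
have Y0 w : 0 <= Y w.
  rewrite /Y innerE; apply: sumr_ge0 => z Az; rewrite mulr_ge0//.
    by apply: (lhat_ge0 Hgame mus Hmus T (fun t h => xs t h w)
      (fun t h => acts t h w) (fun t h => ls t h w) _ t z.1 z.2 tT Az) => *;
      exact: Htraj.
  by have /andP[] := rplan_itv Hgame _ _ _ (Hmu_pol t w tT) Az.
have bD : bmeas (F t) D.
  apply: bmeasD => //; last exact: bmeas_cst.
  apply: bmeasM => //; first exact: bmeas_cst.
  by apply: bmeasD => //; [exact: bmeas_sub bm|exact: bmeasN].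
split=> //.
pose Z w := - (g * m w) + g ^+ 2 * H%:R * kap.
(* Per pair, the first term is the linear part of the expansion and the second the quadratic part;
   [psi] is obtained by replacing visits and visited losses by their conditional means. *)
pose phi (z : X * Act) w := \1_(visit t z.1 z.2) w * ls t (depth z.1) w *
   (- g / q z.1 z.2) + \1_(visit t z.1 z.2) w * (g ^+ 2 * H%:R / q z.1 z.2 ^+ 2).
pose psi (z : X * Act) w := pnu t w z.1 * q z.1 z.2 * lnu t w z.1 z.2 *
   (- g / q z.1 z.2) + pnu t w z.1 * q z.1 z.2 *
   (g ^+ 2 * H%:R / q z.1 z.2 ^+ 2).
have bvl z : bmeas (F t) (fun w => \1_(visit t z.1 z.2) w * ls t (depth z.1) w).
  by apply: bmeasM => //; [exact: bmeas_visit|exact: bmeas_ls].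
have bpq z : bmeas (F t.-1) (fun w => pnu t w z.1 * q z.1 z.2).
  by apply: bmeasM => //; [exact: bmeas_pnu|exact: bmeas_cst].
have bpql z : bmeas (F t.-1)
    (fun w => pnu t w z.1 * q z.1 z.2 * lnu t w z.1 z.2).
  by apply: bmeasM => //; exact: bmeas_lnu.
have FM' : F t.-1 `<=` measurable by exact: subset_trans FM.
have sM := sigma_algebra_measurable_setT (Om := Om).
have cst (r : R) : bmeas measurable (fun _ : Om => r) by exact: bmeas_cst.
apply: (@Eb_expR_le _ _ _ P _ sF' FM' G Z D _ A (fun z w => rp w t z.1 z.2)
  phi psi) => //.
- apply: bmeasD => //; last exact: bmeas_cst.
  by apply: bmeasN => //; apply: bmeasM => //; exact: bmeas_cst.
- exact: bmeas_sub bD.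
- by move=> z Az; exact: bmeas_rp.
- by move=> z w Az; have /andP[] := rplan_itv Hgame _ _ _ (Hmu_pol t w tT) Az.
- move=> z Az; apply: bmeasD => //; apply: bmeasM => //.
    exact: bmeas_sub FM (bvl z).
  exact: bmeas_sub FM (bmeas_visit _ _ _ tT).
- move=> z Az; apply: bmeasD => //; apply: bmeasM => //.
    exact: bmeas_sub FM' (bpql z).
  exact: bmeas_sub FM' (bpq z).
- move=> z B Az FB; have mB := FM' _ FB.
  have bi f : bmeas measurable f -> P.-integrable B (EFin \o f).
    by move=> ?; exact: bmeas_integrable.
  have bv := bmeas_sub _ _ _ FM (bmeas_visit t z.1 z.2 tT).
  have bvl' := bmeas_sub _ _ _ FM (bvl z).
  have bpq' := bmeas_sub _ _ _ FM' (bpq z).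
  have bpql' := bmeas_sub _ _ _ FM' (bpql z).
  rewrite !RintegralD//; [|by apply: bi; exact: bmeasM..].
  have Zr f r : bmeas measurable f ->
      \int[P]_(w in B) (f w * r) = \int[P]_(w in B) f w * r.
    by move=> bf; rewrite RintegralZr//; exact: bi.
  rewrite (Zr _ _ bvl') (Zr _ _ bv) (Zr _ _ bpql') (Zr _ _ bpq').
  by rewrite Eb_visit// Eb_visit_loss.
- move=> w; have -> : D w = - Z w + - (g * Y w) by rewrite /D /Z /m /Y; ring.
  rewrite expRD ler_wpM2l ?expR_ge0//.
  have gY : 0 <= g * Y w by rewrite mulr_ge0.
  have gY1 : - (g * Y w) <= 1 by rewrite (le_trans (_ : _ <= 0))// oppr_le0.
  apply: (le_trans (expR_le1DxD2 _ gY1)); rewrite -addrA lerD2l.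
  have -> : \sum_(z | A z) rp w t z.1 z.2 * phi z w = - (g * Y w) +
     g ^+ 2 * (H%:R * \sum_x \sum_(a in Aset x)
       if (xs t (depth x) w == x) && (acts t (depth x) w == a)
       then rp w t x a / q x a ^+ 2 else 0).
    rewrite /Y innerE pair_big_dep/= !mulr_sumr -sumrN -big_split/=.
    apply: eq_bigr => z _; rewrite lhatE /phi visitE; case: ifP => _.
      by rewrite !mul1r; ring.
    by rewrite !mul0r; ring.
  rewrite lerD2l sqrrN exprMn ler_wpM2l ?sqr_ge0//.
  apply: (inner_lhat_sqr Hgame mus Hmus T (fun t h => xs t h w)
    (fun t h => acts t h w) (fun t h => ls t h w)) => //.
    by move=> *; exact: Htraj.
  exact: Hmu_pol.
- move=> w; rewrite /Z.
  have -> : \sum_(z | A z) rp w t z.1 z.2 * psi z w = - (g * m w) +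
     g ^+ 2 * H%:R * \sum_x \sum_(a in Aset x) pnu t w x * (rp w t x a / q x a).
    rewrite /m innerE pair_big_dep/= !mulr_sumr -sumrN -big_split/=.
    apply: eq_bigr => z /q_gt0 qz; rewrite /psi /ltrue.
    by field; rewrite gt_eqF.
  rewrite lerD2l ler_wpM2l ?mulr_ge0 ?sqr_ge0//.
  apply: le_trans (kappa_ge Hgame mus Hmus (mu t w) (Hmu_pol t w tT)).
  apply: ler_sum => x _; apply: ler_sum => a ax.
  have /andP[r0 _] := rplan_itv Hgame _ _ _ (Hmu_pol t w tT) ax.
  have /andP[p0 p1] := Hpnu t w x tT.
  by rewrite ler_piMl// divr_ge0// ltW// q_gt0.
Qed.

(** Multiplying [lhat] by [q x a] leaves the visited loss [v] in [[0, 1]]. As [c v <= 1] and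
    [v^2 <= v], [expR (c v) <= 1 + (c + c^2) v], and [v] has conditional mean [q x a] times the true
    loss. *)
Lemma loss_deviation_step (c : R) t x a (G : Om -> R) : 0 <= c <= 1 ->
  (1 <= t <= T)%N -> a \in Aset x ->
  bmeas (F t.-1) G -> (forall w, 0 <= G w) ->
  let D w := c * q x a * (lhat w t x a - ltrue w t x a)
             - c ^+ 2 * q x a * ltrue w t x a in
  bmeas (F t) D /\ \int[P]_w (G w * expR (D w)) <= \int[P]_w G w.
Proof.
move=> /andP[c0 c1] tT ax bG G0 D; have [sF' sF FF FM] := F_sigma t tT.
have bl := bmeas_ltrue t x a tT.
have bl' := bmeas_sub _ _ _ FF bl.
have bD : bmeas (F t) D.
  apply: bmeasD => //.
    apply: bmeasM => //; first exact: bmeas_cst.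
    by apply: bmeasD => //; [exact: bmeas_lhat|exact: bmeasN].
  by apply: bmeasN => //; apply: bmeasM => //; exact: bmeas_cst.
split=> //.
pose Z w := (c + c ^+ 2) * q x a * ltrue w t x a.
(* A single pair is involved, hence a one-element index type. *)
pose phi (_ : 'I_1) w :=
  \1_(visit t x a) w * ls t (depth x) w * (c + c ^+ 2).
pose psi (_ : 'I_1) w := pnu t w x * q x a * lnu t w x a * (c + c ^+ 2).
have FM' : F t.-1 `<=` measurable by exact: subset_trans FM.
have sM := sigma_algebra_measurable_setT (Om := Om).
have cst (r : R) : bmeas measurable (fun _ : Om => r) by exact: bmeas_cst.
have bvl : bmeas measurable
    (fun w => \1_(visit t x a) w * ls t (depth x) w).
  apply: bmeas_sub FM _.
  by apply: bmeasM => //; [exact: bmeas_visit|exact: bmeas_ls].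
have bpql : bmeas measurable (fun w => pnu t w x * q x a * lnu t w x a).
  apply: bmeas_sub FM' _; apply: bmeasM => //; last exact: bmeas_lnu.
  by apply: bmeasM => //; [exact: bmeas_pnu|exact: bmeas_cst].
apply: (@Eb_expR_le _ _ _ P _ sF' FM' G Z D _ xpredT (fun _ _ => 1)
  phi psi) => //.
- by apply: bmeasM => //; exact: bmeas_cst.
- exact: bmeas_sub bD.
- by move=> ? _; exact: bmeas_cst.
- by move=> ? _; exact: bmeasM.
- by move=> ? _; exact: bmeasM.
- move=> ? B _ FB; have mB := FM' _ FB.
  rewrite !RintegralZr//; [|by apply: bmeas_integrable..].
  by rewrite Eb_visit_loss.
- move=> w; rewrite big_ord1 mul1r /phi.
  set v := \1_(visit t x a) w * ls t (depth x) w.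
  have /andP[v0 v1] : 0 <= v <= 1.
    have [_ _ l01] := Htraj t _ w tT (depthH x).
    by rewrite /v visitE; case: ((_ == x) && _) => /=;
      [rewrite mul1r|rewrite mul0r lexx ler01].
  have -> : D w = - Z w + c * v.
    rewrite /D /Z lhatE -/v; have := q_gt0 x a ax => q0.
    by field; rewrite gt_eqF.
  rewrite expRD ler_wpM2l ?expR_ge0//.
  apply: (le_trans (expR_le1DxD2 _ _)); first by rewrite mulr_ile1.
  have : v ^+ 2 <= v by rewrite expr2 ler_piMr.
  have := sqr_ge0 c; nra.
- by move=> w; rewrite big_ord1 mul1r /psi /Z /ltrue le_eqVlt; apply/orP; left;
    apply/eqP; ring.
Qed.

Lemma policy_deviation (g i : R) : 0 <= g ->
  let A := [set w | i < \sum_(1 <= t < T.+1)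
    (g * (inner Aset (ltrue w t) (rp w t) - inner Aset (lhat w t) (rp w t))
     - g ^+ 2 * H%:R * kap)] in
  measurable A /\ (P A <= (expR (- i))%:E)%E.
Proof.
move=> g0; apply: (supermartingale_tail P T F _ i HF) => [t|t G] tT.
  have [sF _ _ _] := F_sigma t tT.
  (* Measurability of the increment does not depend on the weight, so the zero weight serves. *)
  by have [] := policy_deviation_step g t (fun=> 0) g0 tT
    (bmeas_cst _ 0 sF) (fun=> lexx 0).
by move=> bG G0; have [] := policy_deviation_step g t G g0 tT bG G0.
Qed.

Lemma loss_deviation (c i : R) x a : 0 <= c <= 1 -> a \in Aset x ->
  let A := [set w | i < \sum_(1 <= t < T.+1)
    (c * q x a * (lhat w t x a - ltrue w t x a)
     - c ^+ 2 * q x a * ltrue w t x a)] in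
  measurable A /\ (P A <= (expR (- i))%:E)%E.
Proof.
move=> c01 ax; apply: (supermartingale_tail P T F _ i HF) => [t|t G] tT.
  have [sF _ _ _] := F_sigma t tT.
  by have [] := loss_deviation_step c t x a (fun=> 0) c01 tT ax
    (bmeas_cst _ 0 sF) (fun=> lexx 0).
by move=> bG G0; have [] := loss_deviation_step c t x a G c01 tT ax bG G0.
Qed.

End Concentration.

(** * Choice of parameters and assembly *)

Theorem theorem2
  (R : realType) (X Act : finType) (H : nat) (depth : X -> nat)
  (Aset : X -> {set Act}) (par : X -> option (X * Act))
  (Hgame : game_wf H depth Aset par)
  (mus : X -> Act -> R) (Hmus : positive_policy Aset mus)
  (T : nat)
  (d : measure_display) (Om : measurableType d) (P : probability Om R)
  (F : nat -> set (set Om)) (HF : filtration T F)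
  (* min-player policies mu^t, F^{t-1}-measurable *)
  (mu : nat -> Om -> X -> Act -> R)
  (Hmu_pol : forall t w, (1 <= t <= T)%N -> is_policy Aset (mu t w))
  (Hmu_meas : forall t x a, (1 <= t <= T)%N ->
      Gmeas (F t.-1) (fun w => mu t w x a))
  (* the data p^{nu^t}_{1:}(x) and l^{nu^t}_h(x,a) of the
     F^{t-1}-measurable max-player policy nu^t *)
  (pnu : nat -> Om -> X -> R) (lnu : nat -> Om -> X -> Act -> R)
  (Hpnu : forall t w x, (1 <= t <= T)%N -> 0 <= pnu t w x <= 1)
  (Hlnu : forall t w x a, (1 <= t <= T)%N -> 0 <= lnu t w x a <= 1)
  (Hpnu_meas : forall t x, (1 <= t <= T)%N ->
      Gmeas (F t.-1) (fun w => pnu t w x))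
  (Hlnu_meas : forall t x a, (1 <= t <= T)%N ->
      Gmeas (F t.-1) (fun w => lnu t w x a))
  (* observed trajectories (x^t_h, a^t_h, l^t_h), F^t-measurable *)
  (xs : nat -> nat -> Om -> X) (acts : nat -> nat -> Om -> Act)
  (ls : nat -> nat -> Om -> R)
  (Htraj : forall t h w, (1 <= t <= T)%N -> (1 <= h <= H)%N ->
      [/\ depth (xs t h w) = h, acts t h w \in Aset (xs t h w)
        & 0 <= ls t h w <= 1])
  (Htraj_meas : forall t h, (1 <= t <= T)%N -> (1 <= h <= H)%N ->
      [/\ Gmeas_fin (F t) (xs t h), Gmeas_fin (F t) (acts t h)
        & Gmeas (F t) (ls t h)])
  (* conditionally on F^{t-1}, the trajectory is distributed as an
     episode played with (mu^s, nu^t) *)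
  (Hcond : forall t x a B, (1 <= t <= T)%N -> a \in Aset x -> F t.-1 B ->
      let E := [set w | xs t (depth x) w = x /\ acts t (depth x) w = a] in
      (P (B `&` E) =
        \int[P]_(w in B) (pnu t w x * rplan H par mus x a)%:E)%E /\
      (\int[P]_(w in B `&` E) (ls t (depth x) w)%:E =
        \int[P]_(w in B) (pnu t w x * rplan H par mus x a * lnu t w x a)%:E)%E)
  (delta : R) (Hdelta : 0 < delta < 1) :
  let ltrue := fun (w : Om) (t : nat) (x : X) (a : Act) =>
      pnu t w x * lnu t w x a in
  let lhat := fun (w : Om) (t : nat) (x : X) (a : Act) =>
      if (xs t (depth x) w == x) && (acts t (depth x) w == a)
      then ls t (depth x) w / rplan H par mus x a else 0 in
  let iota := ln (((A_X Aset).+1)%:R / delta) in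
  exists A : set Om, [/\ measurable A, ((1 - delta)%:E <= P A)%E &
    forall w, A w ->
      regret T H Aset par (ltrue w) (mu^~ w)
      <= Num.max (regret T H Aset par (lhat w) (mu^~ w)) 0
         + 4 * Num.sqrt (iota * H%:R * kappa H Aset par mus * T%:R)].
Proof.
move=> ltrue lhat iota.
have [H0 _ _ _] := Hgame.
have /andP[d0 d1] := Hdelta.
have A1 : 1 <= (A_X Aset).+1%:R :> R by rewrite ler1n.
have iota_gt0 : 0 < iota.
  by rewrite ln_gt0// ltr_pdivlMr// mul1r (lt_le_trans d1).
have expiota : expR (- iota) = delta / (A_X Aset).+1%:R.
  by rewrite expRN lnK ?invf_div// posrE divr_gt0.
(* The parameter [g] divides by [T]; with no rounds the regret is 0. *)
have [T0|T0] := posnP T.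
  exists setT; split=> //.
    by rewrite probability_setT lee_fin gerBl ltW.
  move=> w _; apply: (@le_trans _ _ 0).
    apply: ge_sup => [|_ [nu [_ ->]]]; last by rewrite T0 big_geq.
    by eexists; exists mus; split; [exact: Hmus.1|].
  by rewrite addr_ge0 ?mulr_ge0 ?sqrtr_ge0// le_max lexx orbT.
set k := kappa H Aset par mus.
(* Any value of [xs] shows that [X] is inhabited. *)
have k0 : 0 < k by exact: (kappa_gt0 Hgame mus Hmus (xs 1%N 1%N point)).
(* This [g] balances [iota / g] against [g H k T]; both then equal [S]. *)
pose g := Num.sqrt (iota / (H%:R * T%:R * k)).
have HT0 : 0 < H%:R * T%:R :> R by rewrite mulr_gt0// ltr0n.
have g0 : 0 < g by rewrite sqrtr_gt0 divr_gt0// mulr_gt0.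
have g2 : g ^+ 2 * (H%:R * T%:R * k) = iota.
  rewrite sqr_sqrtr; last by rewrite ltW// divr_gt0// mulr_gt0.
  by rewrite divfK// gt_eqF// mulr_gt0.
pose S := g * k * (H%:R * T%:R).
have S0 : 0 < S by rewrite /S mulr_gt0// mulr_gt0.
have iotaE : iota = g * S by rewrite -g2 /S; ring.
have -> : Num.sqrt (iota * H%:R * k * T%:R) = S.
  rewrite (_ : iota * H%:R * k * T%:R = S ^+ 2); last by rewrite -g2 /S; ring.
  by rewrite sqrtr_sqr gtr0_norm.
(* Capped at 1 as [loss_deviation] requires; the bound it gives is used only when [g * k <= 1]. *)
pose c := Num.min (g * k) 1.
have c01 : 0 <= c <= 1 by rewrite le_min ge_min lexx orbT ler01 mulr_ge0 ?ltW.
pose q := rplan H par mus.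
pose A (z : X * Act) := z.2 \in Aset z.1.
pose bad0 := [set w | iota < \sum_(1 <= t < T.+1)
  (g * (inner Aset (ltrue w t) (rplan H par (mu t w))
        - inner Aset (lhat w t) (rplan H par (mu t w))) - g ^+ 2 * H%:R * k)].
pose bad1 (z : X * Act) := [set w | iota < \sum_(1 <= t < T.+1)
  (c * q z.1 z.2 * (lhat w t z.1 z.2 - ltrue w t z.1 z.2)
   - c ^+ 2 * q z.1 z.2 * ltrue w t z.1 z.2)].
have [m0 P0] : measurable bad0 /\ (P bad0 <= (expR (- iota))%:E)%E.
  exact: (policy_deviation Hgame mus Hmus P F HF mu Hmu_pol
    Hmu_meas pnu lnu Hpnu Hlnu Hpnu_meas Hlnu_meas xs acts ls Htraj Htraj_meas
    Hcond g iota (ltW g0)).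
have bad1_le z : A z ->
    measurable (bad1 z) /\ (P (bad1 z) <= (expR (- iota))%:E)%E.
  exact: (loss_deviation Hgame mus Hmus P F HF pnu lnu Hpnu Hlnu Hpnu_meas
    Hlnu_meas xs acts ls Htraj Htraj_meas Hcond c iota z.1 z.2 c01).
have [m1 P1] := probability_bigsetU_le P _ (index_enum _) _ _ _ bad1_le.
set bads := \big[_/_]_(_ <- _ | _) _ in m1 P1.
have mbad : measurable (bad0 `|` bads) by exact: measurableU.
exists (~` (bad0 `|` bads)); split; first exact: measurableC.
  (* There is one bad event for the policies and one per pair, [A_X + 1] in all, each of probability
     at most [delta / (A_X + 1)]. *)
  rewrite probability_setC// EFinB leeB//.
  apply: le_trans (measureU2 _ m0 m1) _.
  apply: le_trans (leeD P0 P1) _.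
  rewrite -EFinD lee_fin -(pair_big_dep xpredT (fun x a => a \in Aset x)
    (fun _ _ => expR (- iota)))/=.
  under eq_bigr do rewrite sumr_const.
  by rewrite sumrMnr -/(A_X Aset) -mulrS expiota -[leLHS]mulr_natr divfK.
move=> w; rewrite setCU => -[/negP nbad0 nbads].
have {}nbad0 : \sum_(1 <= t < T.+1)
    (inner Aset (ltrue w t) (rplan H par (mu t w))
     - inner Aset (lhat w t) (rplan H par (mu t w))) <= 2 * S.
  (* The compensators sum to [T g^2 H k = g S], and [iota = g S]; dividing by [g] leaves [2 S]. *)
  move: nbad0; rewrite -leNgt sumrB -mulr_sumr sumr_const_nat subSS subn0.
  rewrite lerBlDr -mulr_natr iotaE.
  rewrite (_ : _ + _ = g * (2 * S)); last by rewrite /S; ring.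
  by rewrite ler_pM2l.
apply: (regret_le_estimated Hgame mus Hmus T (fun t h => xs t h w)
  (fun t h => acts t h w) (fun t h => ls t h w) _ _ (fun t => mu t w) g k) => //.
- by move=> *; exact: Htraj.
- move=> t x a tT _; rewrite mulr_ge0//.
    by have /andP[] := Hpnu t w x tT.
  by have /andP[] := Hlnu t w x a tT.
- by move=> *; exact: Hmu_pol.
move=> gk1 x a ax.
have cE : c = g * k by rewrite /c; apply/min_idPl.
have q0 : 0 < q x a by exact: (rplan_gt0 Hgame mus x a Hmus ax).
have : ~ bad1 (x, a) w.
  move=> b; apply: nbads; rewrite /bads -bigcup_seq_cond.
  by exists (x, a) => //=; rewrite mem_index_enum.
move=> /negP; rewrite -leNgt sumrB -!mulr_sumr /= cE iotaE lerBlDr => le.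
(* Multiplying by [c * q x a] turns the goal into the bound that holds outside [bad1]. *)
rewrite -(ler_pM2l (mulr_gt0 (mulr_gt0 g0 k0) q0)).
apply: le_trans le _; rewrite le_eqVlt; apply/orP; left; apply/eqP.
by rewrite /S -/(q x a); field; rewrite !gt_eqF.
Qed.
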